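(* Let $\mathbb{k}$ be a field of characteristic zero and let $A=\sigma(\mathbb{k})\langle x_1,\dots,x_n\rangle$ be a skew PBW extension over $\mathbb{k}$ which is a $\mathbb{k}$-algebra (elements of $\mathbb{k}$ commute with every $x_i$). If $A$ satisfies the PI property, then for all $1\le i<j\le n$ the scalar $c_{i,j}\in\mathbb{k}^*$ appearing in the relation $$x_jx_i-c_{i,j}x_ix_j\in\mathbb{k}+\mathbb{k}x_1+\cdots+\mathbb{k}x_n$$ is a root of unity.
   Context: A $\mathbb{k}$-algebra $A$ satisfies the PI property if there is a polynomial $f\in\mathbb{k}\langle X_1,\dots,X_m\rangle$ in noncommuting variables which is monic (at least one of the monomials of highest total degree appearing in $f$ has coefficient $1$) and such that $f(a_1,\dots,a_m)=0$ for all $a_1,\dots,a_m\in A$. Skew PBW extension: let $R\subseteq A$ be rings. $A$ is a skew PBW extension of $R$, written $A=\sigma(R)\langle x_1,\dots,x_n\rangle$, if (i) $R$ is a subring of $A$; (ii) there are $x_1,\dots,x_n\in A$ such that $A$ is a free left $R$-module with basis $\{x_1^{\alpha_1}\cdots x_n^{\alpha_n}\mid \alpha\in\mathbb{N}^n\}$; (iii) for every $1\le i\le n$ and $r\in R\setminus\{0\}$ there is $c_{i,r}\in R\setminus\{0\}$ with $x_ir-c_{i,r}x_i\in R$; (iv) for every $1\le i,j\le n$ there is $c_{i,j}\in R\setminus\{0\}$ with $x_jx_i-c_{i,j}x_ix_j\in R+Rx_1+\cdots+Rx_n$. Here $R=\mathbb{k}$. *)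

(* Defs.v *)
From mathcomp Require Export all_boot all_order all_algebra.
From mathcomp Require Export finmap.
From mathcomp.multinomials Require Export monalg.

Set Implicit Arguments.
Unset Strict Implicit.
Unset Printing Implicit Defensive.

Import GRing.Theory.
Local Open Scope ring_scope.

(* The free algebra k<X_1, ..., X_m>: the monoid algebra of the words on 'I_m. *)
Definition ncpoly (k : fieldType) (m : nat) := {malg k[{fmonom 'I_m}]}.

Definition nceval (k : fieldType) (A : algType k) (m : nat) (a : 'I_m -> A)
    (f : ncpoly k m) : A :=
  mmap (in_alg A) (fun w : {fmonom 'I_m} => \prod_(i <- w) a i) f.

(* Only one monomial of highest total degree is required to have
   coefficient 1. *)
Definition ncmonic (k : fieldType) (m : nat) (f : ncpoly k m) : Prop :=
  exists w : {fmonom 'I_m},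
    f@_w = 1 /\ (forall v : {fmonom 'I_m}, v \in msupp f -> (fdeg v <= fdeg w)%N).

Definition PI (k : fieldType) (A : algType k) : Prop :=
  exists (m : nat) (f : ncpoly k m),
    ncmonic f /\ (forall a : 'I_m -> A, nceval a f = 0).

(* The inclusion of rings R in A is represented by an injective ring morphism
   iota : R -> A; the left R-module structure on A is r . a = iota r * a. *)
Section SkewPBW.

Variables (R A : nzRingType) (iota : {rmorphism R -> A}) (n : nat) (x : 'I_n -> A).

Definition std_monomial (alpha : 'X_{1..n}) : A :=
  \prod_(i < n) x i ^+ alpha i.

Definition pbw_relation (i j : 'I_n) (c : R) : Prop :=
  c != 0 /\
  exists (r0 : R) (r : 'I_n -> R),
    x j * x i - iota c * (x i * x j) =
      iota r0 + \sum_(l < n) iota (r l) * x l.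

(* In pbw_basis, {malg R['X_{1..n}]} serves only as the type of finitely
   supported families of coefficients indexed by N^n. *)
Record skew_PBW : Prop := SkewPBW {
  pbw_subring : injective iota;
  pbw_basis : forall a : A, exists! p : {malg R['X_{1..n}]},
    a = \sum_(alpha <- msupp p) iota p@_alpha * std_monomial alpha;
  pbw_coef : forall (i : 'I_n) (r : R), r != 0 ->
    exists c : R, c != 0 /\ (exists d : R, x i * iota r - iota c * x i = iota d);
  pbw_comm : forall i j : 'I_n, exists c : R, pbw_relation i j c
}.

End SkewPBW.

(* Main.v *)
Require Import Defs.
From mathcomp Require Import all_boot all_order all_algebra.
From mathcomp Require Import finmap.
From mathcomp.multinomials Require Import monalg.
From mathcomp Require Import zify ring.

(** Filter A by the degree of standard monomials. The commutation relations have
lower terms of degree at most 1, so the filtration is multiplicative and, in top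
degree, X = x_i and Y = x_j generate a quantum plane: Y^v X^u agrees with
c^(uv) X^u Y^v up to terms of degree less than u + v (swap_pow_symbol). Hence a
product of factors X^(u_r) Y^(D - u_r), for r = 0, ..., d-1, has top term
c^(D h - K) X^S Y^(Dd - S), where S is the sum of the u_r, h the sum of the r u_r,
and K does not involve D (prod_symbol).

Let f be an identity of A, and w a word of highest degree d with coefficient 1.
To separate w from the other words, f is evaluated at sums of pairwise different
monomials, one for each position of w: the variable s is replaced by the sum, over
the positions p of w which carry s, of X^(B^p) Y^(D - B^p). All these monomials
have the same degree D, so that words shorter than w only give terms of lower
degree, and the part of degree Dd is indexed by the maps g from positions to
positions, g contributing the coefficient of the word w o g (nceval_symbol).
As A has a basis of standard monomials, the coefficient of each X^S Y^(Dd - S) is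
zero. For S = S(id) this reads
   sum over the g with S(g) = S(id) of f_(w o g) c^(-K(g)) (c^D)^(h(g)) = 0,
and so c^D is a root of a polynomial that is independent of D. For B large,
comparing base B expansions shows that S and h take the same values at g as at id
only if g = id (eq_id_of_moments); so the coefficient of degree h(id) of this
polynomial comes from g = id alone, and is not zero. It has finitely
many roots, whereas D is any large integer; so two powers of c coincide
(unity_root_of_power_roots). *)

Set Implicit Arguments.
Unset Strict Implicit.
Unset Printing Implicit Defensive.

Import GRing.Theory.
Local Open Scope ring_scope.

(** * The degree filtration *)

Section Filtration.

Variables (k : fieldType) (A : algType k) (n : nat) (x : 'I_n -> A).
Implicit Types (p q : {malg k['X_{1..n}]}) (al be : 'X_{1..n}) (a b : A).
Implicit Types (l m : nat).

Local Notation M := (std_monomial x).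
Local Notation U := (@ucm 'I_n).

Definition pbw_eval p : A := mmap (in_alg A) M p.

(** The bound on degrees is strict, so that [filt 0] is zero and lower terms of an
element of degree 0 need no special treatment. *)
Definition filt m a : Prop :=
  exists2 p, (forall al, p@_al != 0 -> (mdeg al < m)%N) & a = pbw_eval p.

Lemma pbw_evalD : {morph pbw_eval : p q / p + q}.
Proof. exact: mmapD. Qed.

Lemma pbw_evalZ (c : k) p : pbw_eval (c *: p) = c *: pbw_eval p.
Proof.
rewrite /pbw_eval (mmapEw (msuppZ_le _ _)) mmapE scaler_sumr.
by apply: eq_bigr => al _; rewrite mcoeffZ /= !mulr_algl scalerA.
Qed.

Lemma pbw_evalU (c : k) al : pbw_eval << c *g al >> = c *: M al.
Proof. by rewrite /pbw_eval mmapU /= mulr_algl. Qed.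

Lemma filt0 m : filt m 0.
Proof.
exists 0; last by rewrite /pbw_eval mmap0.
by move=> al; rewrite mcoeff0 eqxx.
Qed.

Lemma filtD m a b : filt m a -> filt m b -> filt m (a + b).
Proof.
move=> [p lp ->] [q lq ->]; exists (p + q); last by rewrite pbw_evalD.
move=> al; have [/eqP p0|/lp //] := eqVneq p@_al 0.
by have [/eqP q0|/lq //] := eqVneq q@_al 0; rewrite mcoeffD (eqP p0) (eqP q0) addr0 eqxx.
Qed.

Lemma filtZ m (c : k) a : filt m a -> filt m (c *: a).
Proof.
move=> [p lp ->]; exists (c *: p); last by rewrite pbw_evalZ.
move=> al; have [p0|/lp //] := eqVneq p@_al 0.
by rewrite mcoeffZ p0 mulr0 eqxx.
Qed.

Lemma filtB m a b : filt m a -> filt m b -> filt m (a - b).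
Proof. by move=> fa fb; rewrite -scaleN1r; apply: filtD => //; apply: filtZ. Qed.

Lemma filt_sum m (I : Type) (r : seq I) (P : pred I) (F : I -> A) :
  (forall i, P i -> filt m (F i)) -> filt m (\sum_(i <- r | P i) F i).
Proof. by move=> fF; apply: big_ind => //; [apply: filt0 | apply: filtD]. Qed.

Lemma filt_le m l a : (m <= l)%N -> filt m a -> filt l a.
Proof. by move=> ml [p lp ->]; exists p => // al /lp /leq_trans; apply. Qed.

Lemma filt0_eq0 a : filt 0 a -> a = 0.
Proof.
move=> [p lp ->]; suff -> : p = 0 by rewrite /pbw_eval mmap0.
apply/malgP => al; rewrite mcoeff0; apply/eqP/negPn/negP => /lp.
by rewrite ltn0.
Qed.

Lemma filt_mon al m : (mdeg al < m)%N -> filt m (M al).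
Proof.
move=> lm; exists << al >>; last by rewrite pbw_evalU scale1r.
by move=> be; rewrite mcoeffU1; have [<-//|_] := eqVneq al be; rewrite eqxx.
Qed.

(** Reduces a statement closed under linear combinations to standard monomials. *)
Lemma filt_spanned m (Q : A -> Prop) :
  Q 0 -> (forall b b', Q b -> Q b' -> Q (b + b')) ->
  (forall (c : k) b, Q b -> Q (c *: b)) ->
  (forall al, (mdeg al < m)%N -> Q (M al)) ->
  forall a, filt m a -> Q a.
Proof.
move=> Q0 QD QZ QM _ [p lp ->]; rewrite /pbw_eval mmapE big_seq.
apply: (big_ind Q) => // al; rewrite -mcoeff_neq0 => /lp lm.
by rewrite /= mulr_algl; apply: QZ; apply: QM.
Qed.

(** A standard monomial has its variables in increasing order, so a variable may be
put in front of it when no smaller one occurs. *)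
Lemma std_monomial_cons (i : 'I_n) al :
  (forall j : 'I_n, (j < i)%N -> al j = 0%N) -> x i * M al = M (mmul (U i) al).
Proof.
(* The product is noncommutative: it is cut at the factor of index i, and the
   factors before it are all 1. *)
move=> al0; have ME be : M be = \prod_(j <- enum 'I_n) x j ^+ be j.
  by rewrite enumT /std_monomial [index_enum _]unlock.
rewrite !{}ME.
have sorted_enum : pairwise (fun a b : 'I_n => (a < b)%N) (enum 'I_n).
  rewrite -(pairwise_map val ltn) val_enum_ord.
  by rewrite -(sorted_pairwise ltn_trans) iota_ltn_sorted.
have i_enum : i \in enum 'I_n by rewrite mem_enum.
move: sorted_enum; case/splitPr: i_enum => s1 s2.
rewrite pairwise_cat /= => /and3P[/allrelP lt1 _ /andP[/allP lt2 _]].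
rewrite !big_cat !big_cons /=.
have s1_1 be : (forall j : 'I_n, (j < i)%N -> be j = 0%N) ->
    \prod_(j <- s1) x j ^+ be j = 1.
  move=> be0; rewrite big1_seq // => j /= js1.
  by rewrite be0 ?expr0 //; exact: lt1 js1 (mem_head _ _).
rewrite !s1_1 // => [|j ji]; last first.
  by rewrite cmM cmU al0 // -(inj_eq val_inj) /= gtn_eqF.
rewrite !mul1r cmM cmU eqxx add1n exprS mulrA; congr (_ * _).
apply: eq_big_seq => j /lt2 ij.
by rewrite cmM cmU -(inj_eq val_inj) /= ltn_eqF.
Qed.

Lemma std_monomial1 : M mone = 1.
Proof. by rewrite /std_monomial big1 // => i _; rewrite cm1 expr0. Qed.

Lemma std_monomialU i : M (U i) = x i.
Proof.
have /esym := @std_monomial_cons i mone (fun j _ => cm1 j).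
by rewrite std_monomial1 mulr1 mulm1.
Qed.

Lemma cmonom_consP al : al != mone ->
  exists i be, al = mmul (U i) be /\ (forall j : 'I_n, (j < i)%N -> al j = 0%N).
Proof.
move=> al_neq1.
have [i0 ali0] : exists i0, al i0 != 0%N.
  apply/existsP; apply: contraR al_neq1; rewrite negb_exists => /forallP al0.
  by apply/cmP => i; rewrite cm1; apply/eqP; move: (al0 i); rewrite negbK.
case: (@arg_minnP _ i0 (fun i => al i != 0%N) val ali0) => i ali mini.
exists i, (divcm al (U i)); split.
  apply/eqP/cmP => j; rewrite cmM divcmE cmU.
  by case: eqP => [<-|_]; rewrite ?subn0 // subnKC // lt0n.
move=> j ji; apply/eqP; apply: contraTT ji => /mini; by rewrite -leqNgt.
Qed.

Section PBW.

Hypothesis pbwA : skew_PBW (in_alg A) x.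

(** Moving x_i to its place across the smaller variables multiplies by a scalar and
creates lower terms. The scalar is part of the induction: x_l is moved to the left
of x_i, and then acts on a single standard monomial in which it comes first,
together with lower terms to which the induction hypothesis applies. Knowing only
the degree of x_i times the rest of the monomial would not be enough, since that
product has the degree of the monomial at hand. *)
Lemma gen_mul_monomial N al (i : 'I_n) : (mdeg al < N)%N ->
  exists c : k, filt (mdeg al).+1 (x i * M al - c *: M (mmul (U i) al)).
Proof.
elim: N => // N IH in al i *; rewrite ltnS => leN.
have [-> | /cmonom_consP[l [be [al_def al0]]]] := eqVneq al mone.
  by exists 1; rewrite std_monomial1 mulr1 mulm1 std_monomialU scale1r subrr; apply: filt0.
have dal : mdeg al = (mdeg be).+1 by rewrite al_def mdegM mdegU.
have beN : (mdeg be < N)%N by rewrite -dal.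
(* Multiplication by a generator raises the degree by at most 1 below the degree
   of al, by the induction hypothesis. *)
have lower t b : filt (mdeg al) b -> filt (mdeg al).+1 (x t * b).
  move: b; apply: (@filt_spanned _ (fun b => filt (mdeg al).+1 (x t * b)))
    => [|b b' fb fb'|c b fb|ga].
  - by rewrite mulr0; apply: filt0.
  - by rewrite mulrDr; apply: filtD.
  - by rewrite -scalerAr; apply: filtZ.
  rewrite dal ltnS => ga_be; have [|c fc] := IH ga t; first exact: leq_ltn_trans beN.
  rewrite -(subrK (c *: M (mmul (U t) ga)) (x t * M ga)).
  apply: filtD; first by apply: filt_le fc; rewrite !ltnS; lia.
  by apply: filtZ; apply: filt_mon; rewrite mdegM mdegU; lia.
(* al begins with x_l: either x_i may stand in front of it, or the two are swapped. *)
have [il | li] := leqP i l.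
  exists 1; rewrite std_monomial_cons ?scale1r ?subrr; first exact: filt0.
  by move=> j ji; apply: al0; apply: leq_trans il.
have [c [_ [r0 [r rel]]]] := pbw_comm pbwA l i.
have [c' fc'] := IH be i beN.
have be0 (j : 'I_n) : (j < l)%N -> be j = 0%N.
  by move=> /al0; rewrite al_def cmM => /eqP; rewrite addn_eq0 => /andP[_ /eqP].
have swap : x l * M (mmul (U i) be) = M (mmul (U i) al).
  rewrite std_monomial_cons ?al_def ?mulmA ?(mulmC (U l)) // => j jl.
  by rewrite cmM be0 // cmU -(inj_eq val_inj) gtn_eqF //=; lia.
exists (c * c').
have -> : x i * M al =
    c *: (x l * (x i * M be)) + (x i * x l - in_alg A c * (x l * x i)) * M be.
  rewrite al_def -std_monomial_cons // mulrBl /= mulr_algl -scalerAl !mulrA addrC subrK //.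
rewrite rel addrAC; apply: filtD.
  rewrite -scalerA -swap -scalerBr; apply: filtZ; rewrite scalerAr -mulrBr.
  by apply: lower; rewrite dal.
rewrite mulrDl; apply: filtD.
  by rewrite /= mulr_algl; apply: filtZ; apply: filt_mon; lia.
rewrite mulr_suml; apply: filt_sum => t _.
by rewrite /= mulr_algl -scalerAl; apply: filtZ; apply: lower; apply: filt_mon; lia.
Qed.

Lemma filt_gen_mul m (i : 'I_n) a : filt m a -> filt m.+1 (x i * a).
Proof.
move: a; apply: (@filt_spanned _ (fun a => filt m.+1 (x i * a)))
  => [|b b' fb fb'|c b fb|al al_m].
- by rewrite mulr0; apply: filt0.
- by rewrite mulrDr; apply: filtD.
- by rewrite -scalerAr; apply: filtZ.
have [c fc] := gen_mul_monomial i (ltnSn (mdeg al)).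
rewrite -(subrK (c *: M (mmul (U i) al)) (x i * M al)).
apply: filtD; first by apply: filt_le fc; lia.
by apply: filtZ; apply: filt_mon; rewrite mdegM mdegU; lia.
Qed.

Lemma filtMr m l a b : filt m.+1 a -> filt l b -> filt (m + l) (a * b).
Proof.
move=> fa fb; move: a fa; apply: (@filt_spanned _ (fun a => filt (m + l) (a * b)))
  => [|a a' fa fa'|c a fa|].
- by rewrite mul0r; apply: filt0.
- by rewrite mulrDl; apply: filtD.
- by rewrite -scalerAl; apply: filtZ.
elim: m => [|m IH] al al_m.
  have /eqP : mdeg al = 0%N by lia.
  by rewrite mdeg_eq0 => /eqP ->; rewrite std_monomial1 mul1r.
have [-> | /cmonom_consP[i [be [al_def al0]]]] := eqVneq al mone.
  by rewrite std_monomial1 mul1r; apply: filt_le fb; lia.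
rewrite al_def -std_monomial_cons => [|j ji].
  by rewrite -mulrA; apply/filt_gen_mul/IH; move: al_m; rewrite al_def mdegM mdegU; lia.
by apply/eqP; move/eqP: (al0 _ ji); rewrite al_def cmM addn_eq0 => /andP[].
Qed.

Lemma filtMl m l a b : filt m a -> filt l.+1 b -> filt (m + l) (a * b).
Proof.
case: m => [/filt0_eq0 -> _|m fa fb]; first by rewrite mul0r; apply: filt0.
by rewrite addSnnS; apply: filtMr.
Qed.

Lemma pbw_eval_inj : injective pbw_eval.
Proof.
move=> p q epq; have [r [_ r_uniq]] := pbw_basis pbwA (pbw_eval p).
by rewrite -(r_uniq p) // -(r_uniq q) //= epq.
Qed.

(** The standard monomials of degree N are independent modulo terms of lower degree;
the al g may repeat. *)
Lemma top_coef_eq0 N (G : finType) (c : G -> k) (al : G -> 'X_{1..n}) be :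
  filt N (\sum_g c g *: M (al g)) -> mdeg be = N ->
  \sum_(g | al g == be) c g = 0.
Proof.
move=> [p lp ep] dbe; pose q := \sum_g << c g *g al g >>.
have qp : q = p.
  apply: pbw_eval_inj; rewrite -ep /q /pbw_eval raddf_sum /=.
  by apply: eq_bigr => g _; apply: pbw_evalU.
have : q@_be = 0.
  by apply/eqP/negPn/negP; rewrite qp => /lp; rewrite dbe ltnn.
rewrite /q raddf_sum /= => q0; rewrite -[RHS]q0 big_mkcond /=.
by apply: eq_bigr => g _; rewrite mcoeffU; case: eqP.
Qed.

(** Equality of the classes of a and b in the degree m component of the associated
graded algebra. *)
Definition same_symbol m a b : Prop := filt m.+1 b /\ filt m (a - b).

Lemma same_symbol_refl m a : filt m.+1 a -> same_symbol m a a.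
Proof. by move=> fa; split=> //; rewrite subrr; apply: filt0. Qed.

Lemma same_symbol_trans m a b b' :
  same_symbol m a b -> same_symbol m b b' -> same_symbol m a b'.
Proof. by move=> [_ fab] [fb' fbb']; split=> //; rewrite -(subrKA b); apply: filtD. Qed.

Lemma same_symbolZ m (c : k) a b : same_symbol m a b -> same_symbol m (c *: a) (c *: b).
Proof. by move=> [fb fab]; split; rewrite -?scalerBr; apply: filtZ. Qed.

Lemma same_symbolM m l a a' b b' : same_symbol m a a' -> same_symbol l b b' ->
  same_symbol (m + l) (a * b) (a' * b').
Proof.
move=> [fa' fa] [fb' fb]; split; first by rewrite -addnS; apply: filtMr.
rewrite -(subrKA (a' * b)) -mulrBl -mulrBr.
apply: filtD; last exact: filtMr.
apply: filtMl => //; rewrite -(subrK b' b); apply: filtD => //.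
exact: filt_le fb.
Qed.

Lemma filtX (i : 'I_n) m : filt m.+1 (x i ^+ m).
Proof.
elim: m => [|m IH]; first by rewrite expr0 -std_monomial1; apply: filt_mon; rewrite mdeg1.
by rewrite exprS; apply: filt_gen_mul.
Qed.


(** * The quantum plane in top degree *)

Section TwoVariables.

Variables (i j : 'I_n) (c : k).
Hypothesis rel : pbw_relation (in_alg A) x i j c.

Local Notation X := (x i).
Local Notation Y := (x j).

Lemma filt_gen (l : 'I_n) : filt 2 (x l).
Proof. by rewrite -[x l]expr1; apply: filtX. Qed.

Lemma swap_symbol : same_symbol 2 (Y * X) (c *: (X * Y)).
Proof.
split; first by apply/filtZ/filt_gen_mul/filt_gen.
case: rel => _ [r0 [r]]; rewrite /= mulr_algl => ->.
apply: filtD.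
  by rewrite -std_monomial1; apply/filtZ/filt_mon; rewrite mdeg1.
by apply: filt_sum => l _; rewrite mulr_algl; apply/filtZ/filt_gen.
Qed.

(** Each of the uv transpositions of a Y with an X contributes a factor c, and the
multiplicativity of symbols absorbs the lower terms. *)
Lemma swap_pow_symbol u v :
  same_symbol (u + v) (Y ^+ v * X ^+ u) (c ^+ (u * v) *: (X ^+ u * Y ^+ v)).
Proof.
have powM u1 v1 : filt (u1 + v1).+1 (X ^+ u1 * Y ^+ v1).
  by rewrite -addnS; apply: filtMr; apply: filtX.
have swap1 u1 : same_symbol u1.+1 (Y * X ^+ u1) (c ^+ u1 *: (X ^+ u1 * Y)).
  elim: u1 => [|u1 IH].
    by rewrite expr0 mulr1 mul1r scale1r; apply/same_symbol_refl/filt_gen.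
  apply: (@same_symbol_trans _ _ (c *: (X * Y) * X ^+ u1)).
    rewrite exprS mulrA; apply: (@same_symbolM 2 u1); first exact: swap_symbol.
    exact/same_symbol_refl/filtX.
  rewrite -scalerAl -mulrA !exprS -scalerA; apply: same_symbolZ.
  rewrite -mulrA scalerAr; apply: (@same_symbolM 1 u1.+1) => //.
  exact/same_symbol_refl/filt_gen.
elim: v => [|v IH].
  rewrite muln0 !expr0 scale1r mul1r mulr1 addn0; exact/same_symbol_refl/filtX.
apply: (@same_symbol_trans _ _ (Y * (c ^+ (u * v) *: (X ^+ u * Y ^+ v)))).
  rewrite exprS -mulrA addnS; apply: (@same_symbolM 1 (u + v)) => //.
  exact/same_symbol_refl/filt_gen.
rewrite -scalerAr mulnS addnC exprD mulrC -scalerA; apply: same_symbolZ.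
rewrite mulrA exprS mulrA scalerAl addnC addnS -addSn.
by apply: same_symbolM => //; apply/same_symbol_refl/filtX.
Qed.

(** For s = u_0, ..., u_(d-1), moving each Y^(D - u_p) across the later X^(u_r)
contributes (D - u_p) u_r to the exponent of c. The sum over p < r is
D times [outer_weight s] minus [inner_weight s]. *)
Fixpoint outer_weight (s : seq nat) : nat :=
  if s is _ :: s' then sumn s' + outer_weight s' else 0.

Fixpoint inner_weight (s : seq nat) : nat :=
  if s is u :: s' then u * sumn s' + inner_weight s' else 0.

(** The exponent of c is written so that its dependence on D is only through the
base c^D of a power: this is what makes the identity a polynomial in c^D. *)
Lemma prod_symbol D s : all (fun u => u <= D)%N s ->
  same_symbol (D * size s) (\prod_(u <- s) (X ^+ u * Y ^+ (D - u)))
    ((c ^- inner_weight s * (c ^+ D) ^+ outer_weight s) *: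
       (X ^+ sumn s * Y ^+ (D * size s - sumn s))).
Proof.
have c0 : c != 0 by case: rel.
elim: s => [_|u s IH] /=.
  rewrite big_nil muln0 subn0 !expr0 invr1 !mulr1 scale1r.
  by apply: same_symbol_refl; rewrite -(expr0 X); apply: filtX.
case/andP=> uD sD; have {}IH := IH sD.
have S_le : (sumn s <= D * size s)%N.
  by elim: s sD {IH} => //= t s IHs /andP[tD /IHs]; rewrite mulnS => ?; apply: leq_add.
have powM : same_symbol D (X ^+ u * Y ^+ (D - u)) (X ^+ u * Y ^+ (D - u)).
  rewrite -{1}(subnKC uD); apply: same_symbolM; exact/same_symbol_refl/filtX.
rewrite big_cons mulnS; apply: same_symbol_trans (same_symbolM powM IH) _.
rewrite -scalerAr.
have -> : c ^- (u * sumn s + inner_weight s) * c ^+ D ^+ (sumn s + outer_weight s) =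
    (c ^- inner_weight s * c ^+ D ^+ outer_weight s) * c ^+ (sumn s * (D - u)).
  rewrite mulnBr (mulnC _ u) expfB_cond ?(negPf c0) ?add0n; last first.
    by rewrite mulnC leq_mul2l uD orbT.
  rewrite exprD invfM exprD -!exprM (mulnC (sumn s) D).
  move: (c ^+ _) (c ^+ _) (c ^- _) (c ^- _) => a b p q.
  ring.
rewrite -scalerA; apply: same_symbolZ.
set T := (D * size s - sumn s)%N.
have -> : (D + D * size s - (u + sumn s) = (D - u) + T)%N by rewrite /T; lia.
have -> : (D + D * size s = u + ((sumn s + (D - u)) + T))%N by rewrite /T; lia.
have -> : X ^+ u * Y ^+ (D - u) * (X ^+ sumn s * Y ^+ T) =
    X ^+ u * ((Y ^+ (D - u) * X ^+ sumn s) * Y ^+ T) by rewrite !mulrA.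
rewrite !exprD -(mulrA (X ^+ u) (X ^+ _)) (mulrA (X ^+ sumn s)) scalerAr.
apply: same_symbolM; first exact/same_symbol_refl/filtX.
rewrite scalerAl; apply: same_symbolM; last exact/same_symbol_refl/filtX.
exact: swap_pow_symbol.
Qed.

(** The exponent of X^u Y^v; an iterated product, so that [std_monomial_cons]
builds its standard monomial one variable at a time. *)
Definition bimon u v : 'X_{1..n} :=
  iter u (mmul (U i)) (iter v (mmul (U j)) mone).

Lemma bimonE u v (l : 'I_n) : bimon u v l = (u * (i == l) + v * (j == l))%N.
Proof.
elim: u => [|u IH] /=; last by rewrite cmM cmU IH mulSn addnA.
by elim: v => [|v IH] /=; rewrite ?cm1 ?cmM ?cmU ?IH ?mulSn.
Qed.

Lemma mdeg_bimon u v : mdeg (bimon u v) = (u + v)%N.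
Proof.
elim: u => [|u IH] /=; last by rewrite mdegM mdegU IH.
by elim: v => [|v IH] /=; rewrite ?mdeg1 // mdegM mdegU IH.
Qed.

Hypothesis ltij : (i < j)%N.

Lemma std_monomial_bimon u v : M (bimon u v) = X ^+ u * Y ^+ v.
Proof.
have zero u1 v1 (l : 'I_n) : (l < i)%N -> bimon u1 v1 l = 0%N.
  move=> li; rewrite bimonE -!(inj_eq val_inj) /= !gtn_eqF ?muln0 //.
  exact: ltn_trans ltij.
elim: u => [|u IH] /=; last first.
  by rewrite exprS -mulrA -IH std_monomial_cons // => l /zero; apply.
rewrite expr0 mul1r; elim: v => [|v IH] /=; first by rewrite std_monomial1.
rewrite exprS -IH std_monomial_cons // => l lj.
have := bimonE 0 v l; rewrite /= => ->.
by rewrite -!(inj_eq val_inj) /= (gtn_eqF lj) muln0.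
Qed.

Lemma bimon_eq u u' N :
  (bimon u (N - u) == bimon u' (N - u')) = (u == u').
Proof.
apply/eqP/eqP => [/(congr1 (fun al : 'X_{1..n} => al i))|-> //].
by rewrite !bimonE eqxx -!(inj_eq val_inj) /= (gtn_eqF ltij) !muln1 !muln0 !addn0.
Qed.

End TwoVariables.

(** * Evaluating a noncommutative polynomial at sums over positions *)

(** Expanding the product amounts to choosing, for each letter of v, a position of t
that carries this letter. *)
Lemma prod_sum_word (I : eqType) d (t v : d.-tuple I) (b : 'I_d -> A) :
  \prod_(s <- v) (\sum_(p | tnth t p == s) b p) =
  \sum_(g : {ffun 'I_d -> 'I_d} | [seq tnth t (g r) | r <- enum 'I_d] == v)
    \prod_(r < d) b (g r).
Proof.
rewrite big_tuple bigA_distr_big_dep; apply: eq_bigl => g.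
apply/familyP/eqP => [gv | gv r]; last first.
  by rewrite unfold_in [X in _ == X](tnth_nth (tnth t (g r))) -gv
    (nth_map r) ?nth_ord_enum // size_enum_ord.
rewrite -[RHS]map_tnth_enum; apply: eq_map => r; exact/eqP/gv.
Qed.

(** Each map g of positions occurs in the expansion of exactly one word of length d,
namely t o g, whence the single sum over g; shorter words have lower degree. *)
Lemma nceval_symbol m (f : ncpoly k m) d (t : d.-tuple 'I_m) (b : 'I_d -> A) D :
  (0 < D)%N -> (forall r, filt D.+1 (b r)) ->
  (forall v : {fmonom 'I_m}, v \in msupp f -> (fdeg v <= d)%N) ->
  filt (D * d) (nceval (fun s => \sum_(p | tnth t p == s) b p) f -
    \sum_(g : {ffun 'I_d -> 'I_d})
       f@_(FMonom [seq tnth t (g r) | r <- enum 'I_d]) *: \prod_(r < d) b (g r)).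
Proof.
move=> D0 fb fd; set a := fun s => _; pose W (g : {ffun 'I_d -> 'I_d}) :=
  FMonom [seq tnth t (g r) | r <- enum 'I_d].
rewrite /nceval mmapE (bigID (fun v : {fmonom 'I_m} => fdeg v == d)) /=.
set top := (X in X + _ - _); set low := (X in _ + X - _); set R := (X in _ - X).
suff -> : top = R.
  rewrite addrAC subrr add0r /low big_seq_cond; apply: filt_sum => v /andP[vf v_d].
  rewrite mulr_algl; apply: filtZ; apply: (@filt_le (D * size v).+1).
    have : (fdeg v < d)%N by rewrite ltn_neqAle v_d fd.
    rewrite /fdeg -(ltn_pmul2l D0); exact.
  elim: (fmonom_val v) => [|s v' IH] /=.
    by rewrite big_nil muln0 -std_monomial1; apply: filt_mon; rewrite mdeg1.
  rewrite big_cons mulnS -addnS; apply: filtMr => //.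
  by apply: filt_sum.
transitivity (\sum_(v <- msupp f | fdeg v == d)
  \sum_(g | fmonom_val (W g) == v) f@_v *: \prod_(r < d) b (g r)).
  apply: eq_bigr => v /eqP vd; rewrite mulr_algl -scaler_sumr; congr (_ *: _).
  have vd' : size v == d by apply/eqP.
  exact: (prod_sum_word t (Tuple vd')).
rewrite (exchange_big_dep xpredT) //=; apply: eq_bigr => g _; rewrite -/(W g).
rewrite (eq_bigl (pred1 (W g))) => [|v]; last first.
  rewrite /= [RHS]fmP [RHS]eq_sym andb_idl // => /eqP gv.
  by rewrite /fdeg -gv size_map size_enum_ord.
rewrite big_mkcond; have [Wf|Wf] := boolP (W g \in msupp f).
  rewrite (bigD1_seq (W g)) ?fset_uniq //= eqxx [X in _ + X]big1 ?addr0 //.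
  by move=> v /negPf vW; rewrite vW.
rewrite (mcoeff_outdom Wf) scale0r big1_seq // => v /= vf.
by have [vW|] := eqVneq v (W g); rewrite // -vW vf in Wf.
Qed.
End PBW.
End Filtration.


(** * Recovering a map of positions from its weights *)

Lemma outer_weightE s :
  outer_weight s = (\sum_(r < size s) r * nth 0 s r)%N.
Proof.
elim: s => [|u s IH] /=; first by rewrite big_ord0.
rewrite big_ord_recl mul0n add0n /= sumnE (big_nth 0%N) big_mkord IH -big_split /=.
by apply: eq_bigr => r _.
Qed.

Lemma base_digits_inj B d (e e' : 'I_d -> nat) :
  (forall p, e p < B)%N -> (forall p, e' p < B)%N ->
  (\sum_p e p * B ^ p = \sum_p e' p * B ^ p)%N -> e =1 e'.
Proof.
elim: d e e' => [|d IH] e e' eB e'B; first by move=> _ [].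
rewrite !big_ord_recl !expn0 !muln1.
have shift (h : 'I_d.+1 -> nat) : (\sum_(p < d) h (lift ord0 p) * B ^ bump 0 p =
    (\sum_(p < d) h (lift ord0 p) * B ^ p) * B)%N.
  by rewrite big_distrl /=; apply: eq_bigr => p _; rewrite expnSr mulnA.
rewrite !shift => sum_eq; have B0 := leq_ltn_trans (leq0n _) (eB ord0).
have e0 : e ord0 = e' ord0.
  have := congr1 (modn^~ B) sum_eq.
  by rewrite /= ![(_ ord0 + _)%N]addnC !modnMDl !modn_small.
move=> p; case: (unliftP ord0 p) => [p'|] -> //.
apply: (IH (fun p => e (lift ord0 p)) (fun p => e' (lift ord0 p))) => //.
by apply/eqP; rewrite -(eqn_pmul2r B0); apply/eqP/(@addnI (e ord0)); rewrite {2}e0.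
Qed.

(** The digits in base B of the two sums are the number of elements of the fibre of
g over p, and the sum of these elements. Over each p they are 1 and p, so that the
fibre is the singleton of p. No digit exceeds d^2, which explains B. *)
Lemma eq_id_of_moments d (g : 'I_d -> 'I_d) B : B = (d * d).+1 ->
  (\sum_(r < d) B ^ g r = \sum_(r < d) B ^ r)%N ->
  (\sum_(r < d) r * B ^ g r = \sum_(r < d) r * B ^ r)%N -> g =1 id.
Proof.
move=> defB sum0 sum1.
have fibres (wt : 'I_d -> nat) : (\sum_(r < d) wt r * B ^ g r =
    \sum_(p < d) (\sum_(r | g r == p) wt r) * B ^ p)%N.
  rewrite (partition_big g xpredT) //=; apply: eq_bigr => p _.
  by rewrite big_distrl /=; apply: eq_bigr => r /eqP ->.
have fibre_lt (wt : 'I_d -> nat) p : (forall r, wt r <= d)%N ->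
    (\sum_(r | g r == p) wt r < B)%N.
  move=> wtd; rewrite defB ltnS; apply: leq_trans (_ : \sum_(r < d) d <= _)%N.
    by rewrite big_mkcond; apply: leq_sum => r _; case: ifP.
  by rewrite sum_nat_const card_ord.
have d0 (r : 'I_d) : (0 < d)%N by apply: leq_ltn_trans (ltn_ord r).
have dB (r : 'I_d) : (d < B)%N by rewrite defB ltnS leq_pmulr // (d0 r).
have card_fibre p : (\sum_(r | g r == p) 1 = 1)%N.
  apply: (@base_digits_inj B d (fun p => \sum_(r | g r == p) 1)%N (fun=> 1%N)).
  - by move=> q; apply: fibre_lt => r; apply: d0 r.
  - by move=> q; rewrite defB ltnS muln_gt0 !(d0 q).
  apply: etrans (esym (fibres (fun=> 1%N))) _ => /=; under eq_bigr do rewrite mul1n.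
  by rewrite sum0; apply: eq_bigr => r; rewrite mul1n.
have sum_fibre (p : 'I_d) : (\sum_(r | g r == p) r = p)%N.
  apply: (@base_digits_inj B d (fun p => \sum_(r | g r == p) r)%N val).
  - by move=> q; apply: fibre_lt => r; apply: ltnW.
  - by move=> q; exact: ltn_trans (ltn_ord q) (dB q).
  by apply: etrans (esym (fibres val)) sum1.
move=> r; apply: val_inj; rewrite /= -(sum_fibre (g r)) (bigD1 r) //=.
have := card_fibre (g r); rewrite (bigD1 r) //= => -[/eqP].
rewrite sum_nat_eq0 => /forallP none; rewrite big1 ?addn0 // => q q_r.
by have := none q; rewrite q_r.
Qed.

(** Otherwise the powers c^D would be infinitely many roots of P. *)
Lemma unity_root_of_power_roots (k : fieldType) (c : k) (P : {poly k}) D0 :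
  c != 0 -> P != 0 -> (forall D, (D0 <= D)%N -> root P (c ^+ D)) ->
  exists2 m : nat, (0 < m)%N & m.-unity_root c.
Proof.
move=> c0 P0 roots; pose rs := mkseq (fun t => c ^+ (D0 + t)) (size P).
have [rs_uniq|/(uniqPn 0)[a [b [ab b_lt]]]] := boolP (uniq rs).
  have: (size rs < size P)%N.
    apply: max_poly_roots => //; apply/allP => _ /mapP[t _ ->].
    by apply: roots; apply: leq_addr.
  by rewrite size_mkseq ltnn.
rewrite size_mkseq in b_lt; rewrite !nth_mkseq ?(ltn_trans ab) // => c_eq.
exists (b - a)%N; first by rewrite subn_gt0.
rewrite unity_rootE; apply/eqP/(@mulIf _ (c ^+ (D0 + a))); first by rewrite expf_neq0.
by rewrite -exprD mul1r c_eq; congr (_ ^+ _); lia.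
Qed.

(** * Roots of unity *)

Theorem theorem2p28 (k : fieldType) (char_k : [pchar k] =i pred0)
    (A : algType k) (n : nat) (x : 'I_n -> A)
    (pbwA : skew_PBW (in_alg A) x) (piA : PI A) :
  forall (i j : 'I_n) (c : k), (i < j)%N ->
    pbw_relation (in_alg A) x i j c ->
    exists2 m : nat, (0 < m)%N & m.-unity_root c.
Proof.
move=> i j c ltij rel; have c0 : c != 0 by case: rel.
case: piA => m [f [[w [fw w_max]] f0]].
pose d := size w; pose t : d.-tuple 'I_m := in_tuple w; pose B := (d * d).+1.
pose W (g : {ffun 'I_d -> 'I_d}) := FMonom [seq tnth t (g r) | r <- enum 'I_d].
pose s (g : {ffun 'I_d -> 'I_d}) := [seq (B ^ g r)%N | r <- enum 'I_d].
pose g1 : {ffun 'I_d -> 'I_d} := [ffun r => r].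
pose C g := f@_(W g) * c ^- inner_weight (s g).
pose P := \sum_(g | sumn (s g) == sumn (s g1)) C g *: 'X^(outer_weight (s g)).
have size_s g : size (s g) = d by rewrite size_map size_enum_ord.
have sumn_s g : sumn (s g) = (\sum_(r < d) B ^ g r)%N.
  by rewrite sumnE big_map big_enum.
have outer_s g : outer_weight (s g) = (\sum_(r < d) r * B ^ g r)%N.
  rewrite outer_weightE size_s; apply: eq_bigr => r _.
  by rewrite (nth_map r) ?size_enum_ord ?nth_ord_enum.
have W1 : W g1 = w.
  apply/eqP; rewrite fmP /= -[X in _ == X](map_tnth_enum t); apply/eqP/eq_map => r.
  by rewrite ffunE.
(* The bound on D makes all exponents D - B^p of x_j genuine differences. *)
apply: (@unity_root_of_power_roots _ _ P (B ^ d)) => // [|D leD].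
  (* P is nonzero: among its terms, only g = id has exponent h(id). *)
  apply: contraTneq (oner_neq0 k) => P0; rewrite negbK.
  have : P`_(outer_weight (s g1)) = 0 by rewrite P0 coef0.
  rewrite coef_sum (bigD1 g1) //= big1 => [|g /andP[/eqP sum_eq g_g1]].
    rewrite addr0 coefZ coefXn eqxx mulr1 /C W1 fw mul1r => /eqP.
    by rewrite invr_eq0 expf_eq0 (negPf c0) andbF.
  rewrite coefZ coefXn; case: eqP => [outer_eq|]; last by rewrite mulr0.
  case/eqP: g_g1; apply/ffunP => r; rewrite ffunE.
  apply: (@eq_id_of_moments d g B) => //.
    rewrite -sumn_s sum_eq sumn_s; apply: eq_bigr => p _; by rewrite ffunE.
  rewrite -outer_s -outer_eq outer_s; apply: eq_bigr => p _; by rewrite ffunE.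
have B_le (p : 'I_d) : (B ^ p <= D)%N.
  by apply: leq_trans leD; rewrite leq_pexp2l // ltnW.
have D0 : (0 < D)%N by apply: leq_trans leD; rewrite expn_gt0.
pose b (p : 'I_d) := x i ^+ (B ^ p) * x j ^+ (D - B ^ p).
have fb p : filt x D.+1 (b p).
  by rewrite -(subnKC (B_le p)) -addnS; apply: (filtMr pbwA); apply: (filtX pbwA).
have := nceval_symbol pbwA t D0 fb w_max.
rewrite f0 sub0r => /(filtZ (-1)); rewrite scaleN1r opprK => ftop.
pose symb g := (c ^- inner_weight (s g) * (c ^+ D) ^+ outer_weight (s g)).
pose be g := bimon i j (sumn (s g)) (D * d - sumn (s g)).
have fsymb : filt x (D * d) (\sum_g (f@_(W g) * symb g) *: std_monomial x (be g)).
  rewrite -(subKr (\sum_g f@_(W g) *: \prod_(r < d) b (g r)) (\sum_g _)).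
  apply: filtB => //; rewrite -sumrB; apply: filt_sum => g _.
  rewrite -scalerA -scalerBr; apply: filtZ.
  rewrite /be std_monomial_bimon //.
  have -> : \prod_(r < d) b (g r) = \prod_(u <- s g) (x i ^+ u * x j ^+ (D - u)).
    by rewrite big_map enumT [index_enum _]unlock.
  have s_le : all (fun u => u <= D)%N (s g) by apply/allP => _ /mapP[r _ ->].
  by have [_] := prod_symbol pbwA rel s_le; rewrite size_s.
have sum_le g : (sumn (s g) <= D * d)%N.
  rewrite sumn_s mulnC -[X in (X * D)%N]card_ord -sum_nat_const.
  by apply: leq_sum => r _.
have := top_coef_eq0 pbwA fsymb (be := be g1).
rewrite /be mdeg_bimon subnKC // => /(_ erefl) coef0.
rewrite /root /P horner_sum -[X in _ == X]coef0; apply/eqP.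
apply: eq_big => g; first by rewrite bimon_eq.
by rewrite hornerZ hornerXn /C /symb mulrA.
Qed.
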